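(* Let $(Z,\mathcal{G}_Z)$ be the resolution of a convex geometry $(X,\mathcal{G}_X)$ into a family $\{(Y_x,\mathcal{G}_x):x\in X\}$ of convex geometries. Then $(Z,\mathcal{G}_Z)$ is an ordinal convex geometry if and only if $(X,\mathcal{G}_X)$ and all $(Y_x,\mathcal{G}_x)$, $x\in X$, are ordinal convex geometries. Furthermore, in this case, if $\le_Z$, $\le_X$ and $\le_x$ ($x\in X$) denote the partial orders associated to $\mathcal{G}_Z$, $\mathcal{G}_X$ and $\mathcal{G}_x$ respectively, then $(Z,\le_Z)$ is the resolution (in the sense of binary relations) of $(X,\le_X)$ into $\{(Y_x,\le_x):x\in X\}$.
   Context: A convex geometry on a finite nonempty set $X$ is a family $\mathcal{G}\subseteq 2^X$ such that: (G1) $\varnothing\in\mathcal{G}$; (G2) if $F,G\in\mathcal{G}$ then $F\cap G\in\mathcal{G}$; (G3) for every $G\in\mathcal{G}\setminus\{X\}$ there is $x\in X\setminus G$ with $G\cup\{x\}\in\mathcal{G}$. The pair $(X,\mathcal{G})$ is also called a convex geometry. For $A\subseteq X$, the convex hull is $\operatorname{conv}_{\mathcal{G}}(A)=\bigcap\{G\in\mathcal{G}: A\subseteq G\}$, and the set of extreme elements of $A$ is $\operatorname{ex}_{\mathcal{G}}(A)=\{a\in A: a\notin\operatorname{conv}_{\mathcal{G}}(A\setminus\{a\})\}$. Resolution of convex geometries: let $(X,\mathcal{G}_X)$ be a convex geometry (the base) and $\{(Y_x,\mathcal{G}_x):x\in X\}$ a family of convex geometries (the fibers), where the sets $Y_x$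 are pairwise disjoint and disjoint from $X$. Let $Z=\bigcup_{x\in X}Y_x$ and let $\pi\colon Z\to X$ be the projection given by $\pi(z)=x$ for $z\in Y_x$. The resolution of $(X,\mathcal{G}_X)$ into $\{(Y_x,\mathcal{G}_x):x\in X\}$ is the pair $(Z,\mathcal{G}_Z)$, where $\mathcal{G}_Z$ consists of all $A\subseteq Z$ such that: (R1) $\pi(A)\in\mathcal{G}_X$; (R2) $A\cap Y_x\in\mathcal{G}_x$ for all $x\in\pi(A)$; (R3) $Y_x\subseteq A$ for all $x\in\pi(A)\setminus\operatorname{ex}_{\mathcal{G}_X}(\pi(A))$. The resolution is again a convex geometry. A convex geometry $(X,\mathcal{G})$ is ordinal if there is a partial order $\le$ on $X$ such that $\mathcal{G}$ is the family of all ideals of $(X,\le)$, i.e. all $G\subseteq X$ such that $x\le y$ and $y\in G$ imply $x\in G$. Such a partial order is unique (namely $x\le y$ iff $x\in\operatorname{conv}_{\mathcal{G}}(\{y\})$) and is called the partial order associated to $\mathcal{G}$. Resolution of binary relations: given a finite set $X$ with a binary relation $R_X$ and finite pairwise disjoint sets $Y_x$ ($x\in X$), disjoint from $X$, with binary relations $R_x$ on $Y_x$, the resolution of $(X,R_X)$ into $\{(Y_x,R_x):x\in X\}$ is $(Z,R_Z)$, where $Z=\bigcup_{x\in X}Y_x$ and, for $z,z'\in Z$, $z\,R_Z\,z'$ holds iff either there is $x\in X$ with $z,z'\in Y_x$ and $z\,R_x\,z'$, or there are $x\ne x'$ in $X$ with $z\in Y_x$, $z'\in Y_{x'}$ and $x\,R_X\,x'$.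 *)

(* Defs.v *)
From mathcomp Require Import all_boot.

Set Implicit Arguments.
Unset Strict Implicit.
Unset Printing Implicit Defensive.

(* Ground sets are finite sets [X : {set T}] in an ambient finite type [T],   *)
(* so that disjointness of the base and the fibers of a resolution can be     *)
(* stated literally. Relations are given on [T], but only their restriction   *)
(* to the relevant ground set matters.                                        *)

Definition convex_geometry (T : finType) (X : {set T}) (G : {set {set T}}) :
    Prop :=
  [/\ X != set0 /\ G \subset powerset X,
      set0 \in G,
      {in G &, forall F H : {set T}, F :&: H \in G}
    & {in G, forall F : {set T}, F != X ->
        exists2 x, x \in X :\: F & x |: F \in G}].

(* The empty intersection is [setT], but this case does not arise for subsets *)
(* of the ground set of a convex geometry: the ground set is itself convex.   *)
Definition conv (T : finType) (G : {set {set T}}) (A : {set T}) : {set T} :=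
  \bigcap_(F in G | A \subset F) F.

Definition ex (T : finType) (G : {set {set T}}) (A : {set T}) : {set T} :=
  [set a in A | a \notin conv G (A :\ a)].

Definition partial_order_on (T : finType) (X : {set T}) (le : rel T) : Prop :=
  [/\ {in X, reflexive le},
      {in X &, antisymmetric le}
    & {in X & &, transitive le}].

Definition ideals (T : finType) (X : {set T}) (le : rel T) : {set {set T}} :=
  [set F in powerset X |
    [forall x in X, forall y in X, le x y ==> (y \in F) ==> (x \in F)]].

Definition associated_order (T : finType) (X : {set T}) (G : {set {set T}})
    (le : rel T) : Prop :=
  partial_order_on X le /\ G = ideals X le.

Definition ordinal_convex_geometry (T : finType) (X : {set T})
    (G : {set {set T}}) : Prop :=
  convex_geometry X G /\ exists le : rel T, associated_order X G le.

Definition resolution_set (T : finType) (X : {set T}) (Y : T -> {set T}) :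
    {set T} :=
  \bigcup_(x in X) Y x.

(* The default value [z] is only reached when [z] lies in no fiber.           *)
Definition resolution_proj (T : finType) (X : {set T}) (Y : T -> {set T})
    (z : T) : T :=
  odflt z [pick x in X | z \in Y x].

Definition resolution_geometry (T : finType)
    (X : {set T}) (GX : {set {set T}})
    (Y : T -> {set T}) (GY : T -> {set {set T}}) : {set {set T}} :=
  [set A in powerset (resolution_set X Y) |
    let piA := resolution_proj X Y @: A in
    [&& piA \in GX,
        [forall x in piA, A :&: Y x \in GY x]
      & [forall x in piA :\: ex GX piA, Y x \subset A]]].

Definition resolution_rel (T : finType) (X : {set T}) (RX : rel T)
    (Y : T -> {set T}) (RY : T -> rel T) : rel T :=
  fun z z' =>
    [exists x in X, [&& z \in Y x, z' \in Y x & RY x z z']]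
    || [exists x in X, exists x' in X,
          [&& x != x', z \in Y x, z' \in Y x' & RX x x']].

(* Main.v *)
Require Import Defs.
From mathcomp Require Import all_boot.

(** A convex geometry is ordinal exactly when it is closed under binary unions:
    ideals are closed under unions, and conversely the relation
    [x \in conv G [set y]] is a partial order, antisymmetric because any two
    points are separated by a convex set, and each of its ideals is a union of
    hulls of points, hence convex ([ordinal_setU], [setU_associated_order]).

    If the resolution is ordinal, union-closure descends to the base because
    [F |-> \bigcup_(x in F) Y x] embeds the base in the resolution and commutes
    with unions, the projection being its left inverse
    ([setU_closed_base]). It descends to the fiber over [x] because [x] is
    extreme in some convex set [x |: F] of the base, so that filling the fibers
    over [F] and placing an arbitrary nonempty convex set in [Y x] gives a
    convex set of the resolution ([setU_closed_fiber]).

    Conversely, let the base and the fibers be ordinal. The non-extreme points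
    of a convex set of the base are those lying strictly below another of its
    points. Under this reading the
    three conditions that define the sets of the resolution say precisely that a
    set is an ideal of the resolution of the orders
    ([resolution_geometry_ideals]). That relation is a partial order, and the
    ideals of a nonempty poset form a convex geometry. Since a partial order is
    determined by its ideals ([associated_orderE]), this computation also
    identifies the order associated to the resolution. *)

Set Implicit Arguments.
Unset Strict Implicit.
Unset Printing Implicit Defensive.

(** * Hulls and separation in a convex geometry *)

Section ConvexGeometry.

Variables (T : finType) (X : {set T}) (G : {set {set T}}).

Lemma convP (A : {set T}) (x : T) :
  reflect (forall F, F \in G -> A \subset F -> x \in F) (x \in conv G A).
Proof.
apply: (iffP bigcapP) => [h F FG AF|h F /andP[FG AF]]; last exact: h.
by apply: h; rewrite FG.
Qed.

Lemma sub_conv (A : {set T}) : A \subset conv G A.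
Proof. by apply/subsetP=> x xA; apply/convP=> F _ /subsetP; apply. Qed.

Lemma conv_sub (A F : {set T}) : F \in G -> A \subset F -> conv G A \subset F.
Proof. by move=> FG AF; apply/subsetP=> x /convP; apply. Qed.

Hypothesis geom : convex_geometry X G.

Lemma convex_sub (F : {set T}) : F \in G -> F \subset X.
Proof. by case: geom => [[_ /subsetP sG] _ _ _] /sG; rewrite inE. Qed.

Lemma convex_ground : X \in G.
Proof.
case: geom => _ G0 _ G3.
case: (arg_maxnP (fun F : {set T} => #|F|) G0) => F FG maxF.
have [<- //|nFX] := eqVneq F X.
have [x /setDP[_ xF] /maxF] := G3 F FG nFX.
by rewrite /= cardsU1 xF add1n ltnn.
Qed.

Lemma conv_convex (A : {set T}) : A \subset X -> conv G A \in G.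
Proof.
case: geom => _ _ G2 _ AX.
rewrite -(setIidPr (conv_sub convex_ground AX)) /conv.
(* Intersecting with [X] turns the default value [setT] into a convex set. *)
elim/big_rec: _ => [|F B /andP[FG _] XB]; first by rewrite setIT convex_ground.
by rewrite setICA G2.
Qed.

(** A convex set maximal among those avoiding [x] can be enlarged by some
    point, and by maximality this point is [x] itself. *)
Lemma convex_extension (x : T) : x \in X ->
  exists F, [/\ F \in G, x \notin F & x |: F \in G].
Proof.
case: geom => _ G0 _ G3 xX.
have P0 : (set0 \in G) && (x \notin set0) by rewrite G0 inE.
case: (@arg_maxnP _ _ (fun F => (F \in G) && (x \notin F))
         (fun F : {set T} => #|F|) P0) => F /andP[FG xF] maxF.
have nFX : F != X by apply: contraNneq xF => ->.
have [y /setDP[_ yF] yFG] := G3 F FG nFX.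
exists F; split=> //; have [-> //|nxy] := eqVneq x y.
have /maxF : (y |: F \in G) && (x \notin y |: F).
  by rewrite yFG !inE negb_or nxy.
by rewrite /= cardsU1 yF add1n ltnn.
Qed.

Lemma convex_extension_ex (x : T) (F : {set T}) :
  F \in G -> x \notin F -> x \in ex G (x |: F).
Proof.
move=> FG xF; rewrite !inE eqxx /=; apply: contra (xF).
by rewrite setU1K // => /convP; apply.
Qed.

End ConvexGeometry.

Definition setU_closed (T : finType) (G : {set {set T}}) : Prop :=
  {in G &, forall F H : {set T}, F :|: H \in G}.

(** * Ideals of a partial order *)

Section Ideals.

Variables (T : finType) (X : {set T}).

Lemma idealsP (le : rel T) (F : {set T}) :
  reflect (F \subset X /\
           {in X & F, forall x y, le x y -> x \in F})
          (F \in ideals X le).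
Proof.
rewrite inE powersetE; apply: (iffP andP) => [[FX h]|[FX h]]; split=> //.
  move=> x y xX yF lexy; move/forall_inP: h => /(_ x xX) /forall_inP.
  by move=> /(_ y (subsetP FX y yF)) /implyP/(_ lexy)/implyP; apply.
apply/forall_inP=> x xX; apply/forall_inP=> y yX.
by apply/implyP=> lexy; apply/implyP=> yF; apply: h lexy.
Qed.

Lemma ideals_setU_closed (le : rel T) : setU_closed (ideals X le).
Proof.
move=> F H /idealsP[FX hF] /idealsP[HX hH]; apply/idealsP; split.
  by rewrite subUset FX.
move=> x y xX /setUP[yF|yH] lexy; apply/setUP.
  by left; apply: hF lexy.
by right; apply: hH lexy.
Qed.

(** The one-point enlargement of a proper ideal adds a minimal element of its
    complement. *)
Lemma ideals_convex_geometry (le : rel T) :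
  X != set0 -> partial_order_on X le -> convex_geometry X (ideals X le).
Proof.
move=> X0 [lexx le_anti le_trans]; split.
- by split=> //; apply/subsetP=> F /idealsP[FX _]; rewrite powersetE.
- by apply/idealsP; split=> [|x y _]; rewrite ?sub0set ?inE.
- move=> F H /idealsP[FX hF] /idealsP[_ hH]; apply/idealsP; split.
    exact: subset_trans (subsetIl _ _) FX.
  move=> x y xX /setIP[yF yH] lexy.
  by apply/setIP; split; [apply: hF lexy | apply: hH lexy].
move=> F /idealsP[FX hF] nFX.
have /set0Pn[x0 x0XF] : X :\: F != set0.
  by apply: contra nFX; rewrite setD_eq0 eqEsubset FX.
(* A point with the fewest points below it is minimal. *)
case: (arg_minnP (fun x => #|[set y in X | le y x]|) x0XF) => x xXF minx.
have /setDP[xX xF] := xXF; exists x => //; apply/idealsP; split.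
  by rewrite subUset sub1set xX.
move=> y z yX /setU1P[->|zF] lez; apply/setU1P; last by right; apply: hF lez.
have [yF|yF] := boolP (y \in F); [by right | left].
have /minx : y \in X :\: F by rewrite inE yF.
rewrite leqNgt; have [//|nyx] := eqVneq y x.
case/negP; apply: proper_card; apply/properP; split.
  apply/subsetP=> w; rewrite !inE => /andP[wX lewy].
  by rewrite wX; apply: le_trans lez.
exists x; rewrite !inE xX ?lexx //=.
by apply: contra nyx => lexy; apply/eqP/le_anti; rewrite ?lez.
Qed.

(** A partial order is recovered from its ideals, since the hull of a point is
    its principal ideal. *)
Lemma associated_orderE (G : {set {set T}}) (le : rel T) :
  associated_order X G le ->
  {in X &, forall x y, le x y = (x \in conv G [set y])}.
Proof.
move=> [[lexx le_anti le_trans] ->] x y xX yX; apply/idP/convP.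
  by move=> lexy F /idealsP[_ hF]; rewrite sub1set => yF; apply: hF lexy.
have yP : [set w in X | le w y] \in ideals X le.
  apply/idealsP; split; first by apply/subsetP=> w /setIdP[].
  move=> u v uX /setIdP[vX levy] leuv.
  by rewrite inE uX; apply: le_trans levy.
by move=> /(_ _ yP); rewrite sub1set !inE xX yX lexx //=; apply.
Qed.

Lemma ordinal_setU (G : {set {set T}}) :
  ordinal_convex_geometry X G -> setU_closed G.
Proof. by case=> _ [le [_ ->]]; apply: ideals_setU_closed. Qed.

(** Antisymmetry is separation of points: by [convex_extension] there are convex
    sets [F] and [x |: F] with [x \notin F], and one of the two contains
    exactly one of [x] and [y]. An ideal is the union of the hulls of its
    points, hence convex. *)
Lemma setU_associated_order (G : {set {set T}}) :
  convex_geometry X G -> setU_closed G ->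
  associated_order X G (fun x y => x \in conv G [set y]).
Proof.
move=> geom GU; have [_ G0 _ _] := geom; split.
  split=> [x xX|x y xX yX /andP[/convP xy /convP yx]|y x z yX xX zX xy yz].
  - by have := sub_conv G [set x]; rewrite sub1set.
  - have [F [FG xF xFG]] := convex_extension geom xX.
    have [yF|yF] := boolP (y \in F).
      by case/negP: xF; apply: xy; rewrite ?sub1set.
    have /yx : x |: F \in G by [].
    by rewrite sub1set !inE eqxx (negPf yF) orbF => /(_ isT)/eqP.
  apply: subsetP xy; apply: conv_sub; last by rewrite sub1set.
  by apply: (conv_convex geom); rewrite sub1set.
apply/setP=> F; apply/idP/idealsP => [FG|[FX hF]].
  split=> [|x y _ yF /convP]; first exact: (convex_sub geom).
  by apply; rewrite ?sub1set.
have -> : F = \bigcup_(y in F) conv G [set y].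
  apply/setP=> x; apply/idP/bigcupP => [xF|[y yF xy]].
    by exists x => //; have := sub_conv G [set x]; rewrite sub1set.
  apply: (hF x y _ yF xy).
  apply: subsetP xy; apply: (conv_sub (convex_ground geom)).
  by rewrite sub1set (subsetP FX).
elim/big_rec: _ => // y B yF BG; apply: GU => //.
by apply: (conv_convex geom); rewrite sub1set (subsetP FX).
Qed.

(** If no other point of [P] lies above [x], then [P :\ x] is an ideal, so it
    contains the hull of [P :\ x] and [x] is extreme. *)
Lemma ideals_exP (le : rel T) (P : {set T}) (x : T) :
  P \in ideals X le -> x \in P ->
  reflect (exists y, [/\ y \in P, y != x & le x y])
          (x \notin ex (ideals X le) P).
Proof.
move=> /idealsP[PX hP] xP; rewrite inE xP /= negbK.
apply: (iffP (convP _ _ _)) => [hx|[y [yP nyx lexy]] F /idealsP[_ hF] PF].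
  have [/exists_inP[y yP /andP[nyx lexy]]|noy] :=
    boolP [exists y in P, (y != x) && le x y]; first by exists y.
  have /hx/(_ (subxx _)) : P :\ x \in ideals X le; last by rewrite !inE eqxx.
  apply/idealsP; split; first exact: subset_trans (subsetDl _ _) PX.
  move=> u v uX /setD1P[nvx vP] leuv; rewrite !inE (hP u v) // andbT.
  apply: contra noy => /eqP ux; apply/exists_inP; exists v => //.
  by rewrite nvx -ux.
apply: (hF x y) => //; first exact: subsetP xP.
by apply: (subsetP PF); rewrite !inE nyx.
Qed.

End Ideals.

(** * Fibers, projection and order of a resolution *)

Section Resolution.

Variables (T : finType) (X : {set T}) (Y : T -> {set T}).

Hypothesis disjY : {in X &, forall x x', x != x' -> [disjoint Y x & Y x']}.

Lemma fiber_inj (x x' z : T) :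
  x \in X -> x' \in X -> z \in Y x -> z \in Y x' -> x = x'.
Proof.
move=> xX x'X zx zx'; apply/eqP; apply: contraT => /(disjY xX x'X).
by move/pred0P/(_ z); rewrite /= zx zx'.
Qed.

Lemma resolution_projE (x z : T) :
  x \in X -> z \in Y x -> resolution_proj X Y z = x.
Proof.
move=> xX zx; rewrite /resolution_proj; case: pickP => [y /andP[yX zy]|/(_ x)].
  exact: fiber_inj zx.
by rewrite xX zx.
Qed.

Lemma resolution_setP (z : T) :
  reflect (exists2 x, x \in X & z \in Y x) (z \in resolution_set X Y).
Proof. exact: bigcupP. Qed.

Lemma resolution_proj_imP (A : {set T}) (x : T) :
  A \subset resolution_set X Y ->
  reflect (x \in X /\ exists2 z, z \in A & z \in Y x)
          (x \in resolution_proj X Y @: A).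
Proof.
move=> /subsetP AZ; apply: (iffP imsetP) => [[z zA ->]|[xX [z zA zx]]].
  have /resolution_setP[y yX zy] := AZ z zA.
  by rewrite (resolution_projE yX zy); split=> //; exists z.
by exists z; rewrite ?(resolution_projE xX zx).
Qed.

Lemma resolution_geometryP (GX : {set {set T}}) (GY : T -> {set {set T}})
    (A : {set T}) :
  let piA := resolution_proj X Y @: A in
  reflect [/\ A \subset resolution_set X Y, piA \in GX,
              {in piA, forall x, A :&: Y x \in GY x}
            & {in piA, forall x, x \notin ex GX piA -> Y x \subset A}]
          (A \in resolution_geometry X GX Y GY).
Proof.
rewrite inE powersetE /=; apply: (iffP and4P) => -[AZ R1 R2 R3]; split=> //.
- exact/forall_inP.
- by move=> x xA xex; move/forall_inP: R3; apply; rewrite inE xex.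
- exact/forall_inP.
- by apply/forall_inP=> x /setDP[]; apply: R3.
Qed.

Lemma resolution_relE (leX : rel T) (leY : T -> rel T) (x x' z z' : T) :
  x \in X -> x' \in X -> z \in Y x -> z' \in Y x' ->
  resolution_rel X leX Y leY z z' =
    if x == x' then leY x z z' else leX x x'.
Proof.
move=> xX x'X zx zx'; apply/orP/idP.
  case=> [/exists_inP[y yX /and3P[zy z'y le]]|].
    have xy := fiber_inj xX yX zx zy; have x'y := fiber_inj x'X yX zx' z'y.
    by subst x x'; rewrite eqxx.
  case/exists_inP=> y yX /exists_inP[y' y'X /and4P[nyy' zy zy' le]].
  by rewrite (fiber_inj xX yX zx zy) (fiber_inj x'X y'X zx' zy') (negPf nyy').
case: eqVneq => [exx'|nxx'] le; [left | right].
  by apply/exists_inP; exists x; rewrite // zx le exx' zx'.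
apply/exists_inP; exists x => //; apply/exists_inP; exists x' => //.
by apply/and4P.
Qed.

Lemma resolution_rel_partial_order (leX : rel T) (leY : T -> rel T) :
  partial_order_on X leX ->
  {in X, forall x, partial_order_on (Y x) (leY x)} ->
  partial_order_on (resolution_set X Y) (resolution_rel X leX Y leY).
Proof.
move=> [Xrefl Xanti Xtrans] poY; split.
- move=> z /resolution_setP[x xX zx]; rewrite (resolution_relE _ _ xX xX) //.
  by rewrite eqxx; case: (poY x xX) => refl _ _; apply: refl.
- move=> z z' /resolution_setP[x xX zx] /resolution_setP[x' x'X zx'].
  rewrite (resolution_relE _ _ xX x'X) // (resolution_relE _ _ x'X xX) //.
  rewrite (eq_sym x'); case: eqVneq => [exx'|nxx'].
    rewrite -exx' in zx' *; case: (poY x xX) => _ anti _; exact: anti.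
  by move=> /(Xanti x x' xX x'X)/eqP; rewrite (negPf nxx').
move=> z2 z1 z3 /resolution_setP[x2 X2 zx2] /resolution_setP[x1 X1 zx1].
move=> /resolution_setP[x3 X3 zx3].
rewrite (resolution_relE _ _ X1 X2) // (resolution_relE _ _ X2 X3) //.
rewrite (resolution_relE _ _ X1 X3) //.
have [e12|n12] := eqVneq x1 x2; have [e23|n23] := eqVneq x2 x3.
- subst x2 x3; rewrite eqxx; case: (poY x1 X1) => _ _; exact.
- by subst x2; rewrite (negPf n23).
- by subst x3; rewrite (negPf n12).
have [e13|n13] := eqVneq x1 x3; last exact: Xtrans.
(* Two steps that leave a fiber and return to it would contradict antisymmetry
   in the base. *)
subst x3 => le12 le21; case/eqP: n12; apply: Xanti => //; exact/andP.
Qed.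

(** * The resolution of ordinal geometries *)

Hypothesis Y_neq0 : {in X, forall x, Y x != set0}.

(** An ideal of the resolved order that meets [Y x'] contains every fiber lying
    over a point strictly below [x']. Fibers being nonempty, this makes its
    projection an ideal; it also fills the fibers over the non-extreme points
    of the projection. *)
Lemma resolution_geometry_ideals (leX : rel T) (leY : T -> rel T) :
  resolution_geometry X (ideals X leX) Y (fun x => ideals (Y x) (leY x))
    = ideals (resolution_set X Y) (resolution_rel X leX Y leY).
Proof.
apply/setP=> A; apply/resolution_geometryP/idealsP => [[AZ R1 R2 R3]|[AZ hA]].
  split=> // z z' /resolution_setP[x xX zx] z'A.
  have /resolution_setP[x' x'X zx'] := subsetP AZ z' z'A.
  have x'A : x' \in resolution_proj X Y @: A.
    by apply/resolution_proj_imP=> //; split=> //; exists z'.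
  rewrite (resolution_relE _ _ xX x'X) //; case: eqVneq => [exx'|nxx'] le.
    subst x'; have /idealsP[_ hR2] := R2 x x'A.
    have z'AY : z' \in A :&: Y x by apply/setIP.
    by have /setIP[] := hR2 z z' zx z'AY le.
  have xA : x \in resolution_proj X Y @: A.
    by have /idealsP[_ hR1] := R1; apply: hR1 le.
  apply: subsetP zx; apply: R3 => //; apply/ideals_exP => //.
  by exists x'; rewrite eq_sym.
have below x x' : x \in X -> x' \in resolution_proj X Y @: A -> x != x' ->
    leX x x' -> Y x \subset A.
  move=> xX /(resolution_proj_imP _ AZ)[x'X [z' z'A zx']] nxx' le.
  apply/subsetP=> z zx; apply: (hA z z') => //.
    by apply/resolution_setP; exists x.
  by rewrite (resolution_relE _ _ xX x'X) // (negPf nxx').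
have R1 : resolution_proj X Y @: A \in ideals X leX.
  apply/idealsP; split=> [|x x' xX x'A le].
    by apply/subsetP=> x /(resolution_proj_imP _ AZ)[].
  have [-> //|nxx'] := eqVneq x x'.
  have /set0Pn[z zx] := Y_neq0 xX.
  apply/resolution_proj_imP=> //; split=> //; exists z => //.
  by apply: (subsetP (below _ _ xX x'A nxx' le)).
split=> // x xA; have [xX _] := resolution_proj_imP x AZ xA.
  apply/idealsP; split=> [|z z' zx /setIP[z'A zx'] le]; first exact: subsetIr.
  apply/setIP; split=> //; apply: (hA z z') => //.
    by apply/resolution_setP; exists x.
  by rewrite (resolution_relE _ _ xX xX) // eqxx.
case/(ideals_exP R1 xA) => y [yA nyx le].
by apply: below le; rewrite // eq_sym.
Qed.

Lemma resolution_set_neq0 : X != set0 -> resolution_set X Y != set0.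
Proof.
case/set0Pn=> x xX; have /set0Pn[z zx] := Y_neq0 xX.
by apply/set0Pn; exists z; apply/resolution_setP; exists x.
Qed.

Lemma eq_resolution_geometry (GX : {set {set T}})
    (GY GY' : T -> {set {set T}}) :
  {in X, GY =1 GY'} ->
  resolution_geometry X GX Y GY = resolution_geometry X GX Y GY'.
Proof.
move=> eqG; apply/setP=> A; apply/resolution_geometryP/resolution_geometryP.
  case=> AZ R1 R2 R3; split=> // x xA.
  have [xX _] := resolution_proj_imP x AZ xA.
  by rewrite -eqG // R2.
case=> AZ R1 R2 R3; split=> // x xA.
have [xX _] := resolution_proj_imP x AZ xA.
by rewrite eqG // R2.
Qed.

Lemma resolution_associated_order (GX : {set {set T}})
    (GY : T -> {set {set T}}) (leX : rel T) (leY : T -> rel T) :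
  associated_order X GX leX ->
  {in X, forall x, associated_order (Y x) (GY x) (leY x)} ->
  associated_order (resolution_set X Y) (resolution_geometry X GX Y GY)
    (resolution_rel X leX Y leY).
Proof.
move=> [poX ->] oY; split.
  by apply: resolution_rel_partial_order => // x /oY[].
rewrite -resolution_geometry_ideals; apply: eq_resolution_geometry.
by move=> x /oY[].
Qed.

(** * Union-closure descends to the base and the fibers *)

Section Descent.

Variables (GX : {set {set T}}) (GY : T -> {set {set T}}).
Hypothesis geomX : convex_geometry X GX.
Hypothesis geomY : {in X, forall x, convex_geometry (Y x) (GY x)}.
Hypothesis GZU : setU_closed (resolution_geometry X GX Y GY).

Lemma resolution_set_sub (F : {set T}) :
  F \subset X -> resolution_set F Y \subset resolution_set X Y.
Proof.
move=> FX; apply/bigcupsP=> x xF; apply: bigcup_sup; exact: subsetP xF.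
Qed.

Lemma resolution_proj_set (F : {set T}) :
  F \subset X -> resolution_proj X Y @: resolution_set F Y = F.
Proof.
move=> FX; apply/setP=> x.
apply/(resolution_proj_imP _ (resolution_set_sub FX))/idP.
  case=> xX [z /bigcupP[y yF zy] zx].
  by rewrite (fiber_inj xX (subsetP FX y yF) zx zy).
move=> xF; have xX := subsetP FX x xF; split=> //.
have /set0Pn[z zx] := Y_neq0 xX.
by exists z => //; apply/bigcupP; exists x.
Qed.

Lemma resolution_set_convex (F : {set T}) :
  F \in GX -> resolution_set F Y \in resolution_geometry X GX Y GY.
Proof.
move=> FG; have FX := convex_sub geomX FG.
have full x : x \in F -> Y x \subset resolution_set F Y.
  exact: bigcup_sup.
apply/resolution_geometryP; rewrite resolution_proj_set //.
split=> // [|x xF|x xF _]; [exact: resolution_set_sub| |exact: full].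
rewrite (setIidPr (full x xF)); apply: convex_ground.
exact/geomY/(subsetP FX).
Qed.

Lemma setU_closed_base : setU_closed GX.
Proof.
move=> F H FG HG; have [FX HX] := (convex_sub geomX FG, convex_sub geomX HG).
have := GZU (resolution_set_convex FG) (resolution_set_convex HG).
case/resolution_geometryP=> _ + _ _.
by rewrite imsetU !resolution_proj_set.
Qed.

Lemma proj_fiber_extension (F A : {set T}) (x : T) :
  F \subset X -> x \in X -> A \subset Y x -> A != set0 ->
  resolution_proj X Y @: (resolution_set F Y :|: A) = x |: F.
Proof.
move=> FX xX AY /set0Pn[z zA]; rewrite imsetU resolution_proj_set // setUC.
congr (_ :|: _); apply/setP=> y; rewrite inE; apply/imsetP/eqP.
  by case=> w wA ->; rewrite (resolution_projE xX (subsetP AY w wA)).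
by move=> ->; exists z; rewrite ?(resolution_projE xX (subsetP AY z zA)).
Qed.

Lemma fiber_extension_trace (F A : {set T}) (x : T) :
  F \subset X -> x \in X -> x \notin F -> A \subset Y x ->
  (resolution_set F Y :|: A) :&: Y x = A.
Proof.
move=> FX xX xF AY; rewrite setIUl (setIidPl AY).
apply/setUidPr/subsetP=> z /setIP[/bigcupP[y yF zy] zx].
by case/negP: xF; rewrite (fiber_inj xX (subsetP FX y yF) zx zy).
Qed.

(** The fiber over [x] need not be filled because [x] is extreme in
    [x |: F]. *)
Lemma fiber_extension_convex (F A : {set T}) (x : T) :
  F \in GX -> x \in X -> x \notin F -> x |: F \in GX ->
  A \in GY x -> A != set0 ->
  resolution_set F Y :|: A \in resolution_geometry X GX Y GY.
Proof.
move=> FG xX xF xFG AG A0.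
have FX := convex_sub geomX FG; have AY := convex_sub (geomY xX) AG.
have full y : y \in F -> Y y \subset resolution_set F Y :|: A.
  by move=> yF; apply: subset_trans (subsetUl _ _); apply: bigcup_sup.
apply/resolution_geometryP; rewrite (@proj_fiber_extension F A x) //.
split=> // [|y /setU1P[->|yF]|y /setU1P[->|yF]].
- rewrite subUset resolution_set_sub //=; apply: subset_trans AY _.
  exact: bigcup_sup.
- by rewrite fiber_extension_trace.
- rewrite (setIidPr (full y yF)); apply: convex_ground.
  exact/geomY/(subsetP FX).
- by rewrite convex_extension_ex.
- by move=> _; apply: full.
Qed.

Lemma setU_closed_fiber : {in X, forall x, setU_closed (GY x)}.
Proof.
move=> x xX A B AG BG.
have [->|A0] := eqVneq A set0; first by rewrite set0U.
have [->|B0] := eqVneq B set0; first by rewrite setU0.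
have [F [FG xF xFG]] := convex_extension geomX xX.
have AY := convex_sub (geomY xX) AG; have BY := convex_sub (geomY xX) BG.
have ABY : A :|: B \subset Y x by rewrite subUset AY.
have AB0 : A :|: B != set0.
  by apply: contra A0; rewrite setU_eq0 => /andP[].
have FX := convex_sub geomX FG.
have := GZU (fiber_extension_convex FG xX xF xFG AG A0)
            (fiber_extension_convex FG xX xF xFG BG B0).
rewrite -setUUr => /resolution_geometryP[_ _ + _].
rewrite (proj_fiber_extension FX xX ABY AB0) => /(_ x (setU11 _ _)).
by rewrite fiber_extension_trace.
Qed.

End Descent.

End Resolution.

Theorem theorem4p14 (T : finType) (X : {set T}) (GX : {set {set T}})
    (Y : T -> {set T}) (GY : T -> {set {set T}})
    (geomX : convex_geometry X GX)
    (geomY : {in X, forall x, convex_geometry (Y x) (GY x)})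
    (disjY : {in X &, forall x x', x != x' -> [disjoint Y x & Y x']})
    (disjXY : {in X, forall x, [disjoint X & Y x]}) :
  let Z := resolution_set X Y in
  let GZ := resolution_geometry X GX Y GY in
  (ordinal_convex_geometry Z GZ <->
     ordinal_convex_geometry X GX /\
     {in X, forall x, ordinal_convex_geometry (Y x) (GY x)}) /\
  (ordinal_convex_geometry Z GZ ->
   forall (leZ leX : rel T) (leY : T -> rel T),
     associated_order Z GZ leZ ->
     associated_order X GX leX ->
     {in X, forall x, associated_order (Y x) (GY x) (leY x)} ->
     {in Z &, forall z z', leZ z z' = resolution_rel X leX Y leY z z'}).
Proof.
move=> Z GZ.
have Y0 : {in X, forall x, Y x != set0} by move=> x /geomY[[]].
split; last first.
  move=> _ leZ leX leY oZ oX oY z z' zZ z'Z.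
  have oR := resolution_associated_order disjY Y0 oX oY.
  by rewrite (associated_orderE oZ) // (associated_orderE oR).
split=> [ordZ|[ordX ordY]].
  have GZU := ordinal_setU ordZ; split=> [|x xX].
    split=> //; exists (fun x y => x \in conv GX [set y]).
    by apply: setU_associated_order => //; apply: setU_closed_base GZU.
  split; first exact: geomY.
  exists (fun y z => y \in conv (GY x) [set z]).
  apply: setU_associated_order; first exact: geomY.
  by have := setU_closed_fiber disjY Y0 geomX geomY GZU; apply.
have oX := setU_associated_order geomX (ordinal_setU ordX).
have oY : {in X, forall x, associated_order (Y x) (GY x)
                             (fun y z => y \in conv (GY x) [set z])}.
  move=> x xX; apply: setU_associated_order; first exact: geomY.
  exact: ordinal_setU (ordY x xX).
have oZ := resolution_associated_order disjY Y0 oX oY.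
split; last by eexists; apply: oZ.
have [poZ eqZ] := oZ; rewrite /GZ eqZ; apply: ideals_convex_geometry poZ.
by apply: resolution_set_neq0 => //; case: geomX => [[]].
Qed.
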